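(* Let $p,q$ be non-zero complex numbers with $pq\neq\pm1$ and let $T=\begin{pmatrix} a&\beta\\ \gamma&d\end{pmatrix}\in GL_{p,q}(1|1)$. Then for every positive integer $n$ the matrix $T^n$ (the $n$-th power of $T$) has the form $$T^n=\begin{pmatrix} A_n & B_n\\ C_n& D_n\end{pmatrix},$$ where $$A_n=a^n+F_n(a,q^{-1}d)\,\beta\gamma,\qquad B_n=G_n(a,q^{-1}d)\,\beta,$$ $$D_n=d^n+F_n(d,p^{-1}a)\,\gamma\beta,\qquad C_n=G_n(d,p^{-1}a)\,\gamma .$$
   Context: Setting: $a,\beta,\gamma,d$ are elements of a unital associative $\mathbb{C}$-algebra. The matrix $T=\begin{pmatrix} a&\beta\\ \gamma&d\end{pmatrix}$ is said to belong to $GL_{p,q}(1|1)$ if $a\beta=q\beta a$, $d\beta=q\beta d$, $a\gamma=p\gamma a$, $d\gamma=p\gamma d$, $\beta\gamma+pq^{-1}\gamma\beta=0$, $\beta^2=0=\gamma^2$, $ad-da=(p-q^{-1})\gamma\beta$. It is a standing assumption that $a$ and $d$ are invertible. Matrix powers are taken with the ordinary matrix product (with non-commuting entries multiplied in order). Notation: $\langle N\rangle_{pq}=\dfrac{1-(pq)^{-N}}{1-(pq)^{-1}}$. The functions $F_n$, $G_n$ are defined by $$F_n(a,q^{-1}d)\,\beta\gamma=\sum_{k=0}^{n-2}\langle n-k-1\rangle_{pq}\,a^{n-k-2}(q^{-1}d)^k\beta\gamma,\qquad G_n(a,q^{-1}d)\,\beta=\sum_{k=0}^{n-1}a^{n-k-1}(q^{-1}d)^k\beta,$$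 (empty sums are zero), and, correspondingly, $$F_n(d,p^{-1}a)\,\gamma\beta=\sum_{k=0}^{n-2}\langle n-k-1\rangle_{pq}\,d^{n-k-2}(p^{-1}a)^k\gamma\beta,\qquad G_n(d,p^{-1}a)\,\gamma=\sum_{k=0}^{n-1}d^{n-k-1}(p^{-1}a)^k\gamma.$$ *)

(* Defs.v *)
From HB Require Import structures.
From mathcomp Require Import all_boot all_order all_algebra.
From mathcomp Require Import reals complex.
Set Implicit Arguments.
Unset Strict Implicit.
Unset Printing Implicit Defensive.
Import Order.TTheory GRing.Theory Num.Theory.
Local Open Scope ring_scope.

(* The complex numbers are R[i] for an arbitrary model R : realType of the
   real numbers; a unital associative complex algebra is an algType R[i]. *)

Definition mx22 (A : nzRingType) (a b c d : A) : 'M[A]_2 :=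
  \matrix_(i, j) if i == 0 then (if j == 0 then a else b)
                 else (if j == 0 then c else d).

(* algType provides no unit predicate, so two-sided invertibility is spelled
   out. *)
Definition invertible (A : nzRingType) (x : A) : Prop :=
  exists y : A, x * y = 1 /\ y * x = 1.

(* The defining relations only: invertibility of the diagonal entries is a
   separate hypothesis wherever it is needed. *)
Definition in_GLpq (K : fieldType) (A : algType K) (p q : K) (T : 'M[A]_2)
    : Prop :=
  let a := T 0 0 in let beta := T 0 1 in
  let gamma := T 1 0 in let d := T 1 1 in
  [/\ a * beta = q *: (beta * a) /\ d * beta = q *: (beta * d),
      a * gamma = p *: (gamma * a) /\ d * gamma = p *: (gamma * d),
      beta * gamma + (p * q^-1) *: (gamma * beta) = 0,
      beta * beta = 0 /\ gamma * gamma = 0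
    & a * d - d * a = (p - q^-1) *: (gamma * beta)].

Definition bracket (K : fieldType) (r : K) (N : nat) : K :=
  (1 - r ^- N) / (1 - r^-1).

(* x and y need not commute: the order of the factors matters. The strict
   bounds k < n.-1 and k < n make the sums empty for n <= 1 and n = 0
   respectively, and within them the natural-number subtractions are exact. *)
Definition Fpoly (K : fieldType) (A : algType K) (r : K) (n : nat) (x y : A)
    : A :=
  \sum_(0 <= k < n.-1) bracket r (n - k - 1) *: (x ^+ (n - k - 2) * y ^+ k).

Definition Gpoly (A : nzRingType) (n : nat) (x y : A) : A :=
  \sum_(0 <= k < n) x ^+ (n - k - 1) * y ^+ k.

(* Main.v *)
(* T^(n+1) = T^n T gives A_(n+1) = A_n a + B_n gamma and
   B_(n+1) = A_n beta + B_n d. Since beta d = (q^-1 d) beta and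
   beta gamma beta = 0, the second recursion is that of G_n. Since
   beta gamma a = (pq)^-1 a beta gamma, and a and d commute in front of
   beta gamma, the first one is <N+1> = 1 + (pq)^-1 <N> on the coefficients of
   F_n. The bottom row follows by the symmetry exchanging a with d, beta with
   gamma and p with q, which preserves the defining relations. *)
Require Import Defs.
From HB Require Import structures.
From mathcomp Require Import all_boot all_order all_algebra.
From mathcomp Require Import reals complex.
Set Implicit Arguments.
Unset Strict Implicit.
Unset Printing Implicit Defensive.
Import Order.TTheory GRing.Theory Num.Theory.
Local Open Scope ring_scope.

Lemma bracket1 (K : fieldType) (r : K) : r != 1 -> bracket r 1 = 1.
Proof.
by move=> r1; rewrite /bracket expr1 divff // subr_eq0 eq_sym invr_eq1.
Qed.

Lemma bracketS (K : fieldType) (r : K) (N : nat) :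
  r != 1 -> bracket r N.+1 = 1 + r^-1 * bracket r N.
Proof.
move=> r1; have u : 1 - r^-1 != 0 by rewrite subr_eq0 eq_sym invr_eq1.
rewrite /bracket mulrA -[X in _ = X + _](divff u) -mulrDl; congr (_ / _).
by rewrite mulrBr mulr1 -!exprVn exprS addrA subrK.
Qed.

Lemma GpolyS (A : nzRingType) (n : nat) (x y : A) :
  Gpoly n.+1 x y = x ^+ n + Gpoly n x y * y.
Proof.
rewrite /Gpoly big_nat_recl // subn0 subn1 expr0 mulr1; congr (_ + _).
rewrite mulr_suml; apply: eq_bigr => k _.
by rewrite subSS exprSr mulrA.
Qed.

(** Splitting each bracket by <N+1> = 1 + r^-1 <N> separates the summands into those of F_n, scaled
    by r^-1, and those of G_n. The factor [w] stands for beta gamma: [x] and powers of [y] need only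
    commute in front of it. *)
Lemma FpolyS_mul (K : fieldType) (A : algType K) (r : K) (n : nat)
    (x y w : A) :
  r != 1 -> (forall k, y ^+ k * x * w = x * y ^+ k * w) ->
  Fpoly r n.+1 x y * w = r^-1 *: (Fpoly r n x y * x * w) + Gpoly n x y * w.
Proof.
move=> r1 yxw; case: n => [|n].
  by rewrite /Fpoly /Gpoly !big_geq // !mul0r scaler0 addr0.
rewrite /Fpoly /Gpoly /= !big_nat_recr //= [in LHS]mulrDl [in RHS]mulrDl addrA.
(* The top summand k = n has bracket <1> = 1 and matches the top summand of G; F on the right has no
   such term. *)
congr (_ + _); last first.
  have -> : (n.+2 - n - 1 = 1)%N by rewrite -addn2 addKn.
  have -> : (n.+2 - n - 2 = 0)%N by rewrite -addn2 addKn.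
  by rewrite bracket1 // scale1r subSnn.
rewrite !mulr_suml scaler_sumr -big_split /=.
apply: eq_big_nat => k /andP[_ kn].
(* Writing n through k < n turns the truncated subtractions in the exponents into successors. *)
have [m ->] : exists m, n = (k + m.+1)%N.
  by exists (n - k).-1; rewrite prednK ?subn_gt0 // subnKC // ltnW.
have E1 : ((k + m.+1).+2 - k = m.+3)%N by rewrite -!addnS addKn.
have E2 : ((k + m.+1).+1 - k = m.+2)%N by rewrite -!addnS addKn.
rewrite E1 E2 !subSS !subn0 bracketS // scalerDl scale1r mulrDl addrC.
congr (_ + _); rewrite -!scalerAl scalerA; congr (_ *: _).
by rewrite -!mulrA [y ^+ k * (x * w)]mulrA yxw exprSr !mulrA.
Qed.

(** Moving [w] leftwards past a power of [y] costs only a scalar and brings it next to the pair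
    [y * x], where the exchange is allowed. *)
Lemma exp_swap_mul (K : fieldType) (A : algType K) (s : K) (x y w : A)
    (k : nat) :
  y * w = s *: (w * y) -> y * x * w = x * y * w ->
  y ^+ k * x * w = x * y ^+ k * w.
Proof.
move=> yw yxw.
have ykw j : exists t, y ^+ j * w = t *: (w * y ^+ j).
  elim: j => [|j [t IH]]; first by exists 1; rewrite scale1r !expr0 mulr1 mul1r.
  exists (t * s); rewrite [in LHS]exprS -mulrA IH -scalerAr.
  by rewrite [y * _]mulrA yw -scalerAl scalerA -mulrA -exprS.
elim: k => [|k IH]; first by rewrite expr0 mul1r mulr1.
have [t tE] := ykw k.
rewrite exprS -!mulrA; rewrite -mulrA in IH; rewrite IH.
rewrite -mulrA tE -!scalerAr; congr (_ *: _).
by rewrite !mulrA yxw.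
Qed.

(** Solving for [b * c] in terms of [c * b] settles the two relations not visibly symmetric, since
    (q p^-1)(p q^-1) = 1 and (q - p^-1) p q^-1 = p - q^-1. *)
Lemma GLpq_sym (K : fieldType) (A : algType K) (p q : K) (a b c d : A) :
  p != 0 -> q != 0 ->
  in_GLpq p q (mx22 a b c d) -> in_GLpq q p (mx22 d c b a).
Proof.
move=> p0 q0; rewrite /in_GLpq !mxE /=.
case=> -[ab db] [ac dc] bc [bb cc] ad.
have bcE : b * c = - ((p * q^-1) *: (c * b)) by apply/eqP; rewrite -addr_eq0 bc.
split=> //.
  by rewrite bcE scalerN scalerA mulrA divfK // divff // scale1r subrr.
rewrite bcE -opprB ad scalerN scalerA; congr (- (_ *: _)).
by rewrite mulrBl mulrCA divff // mulr1 mulrA mulVf // mul1r.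
Qed.

Lemma GLpq_top_row (K : fieldType) (A : algType K) (p q : K) (a b c d : A)
    (n : nat) :
  p != 0 -> q != 0 -> p * q != 1 -> in_GLpq p q (mx22 a b c d) ->
  let An m := a ^+ m + Fpoly (p * q) m a (q^-1 *: d) * (b * c) in
  let Bn m := Gpoly m a (q^-1 *: d) * b in
  An n * a + Bn n * c = An n.+1 /\ An n * b + Bn n * d = Bn n.+1.
Proof.
move=> p0 q0 pq1; rewrite /in_GLpq !mxE /=.
case=> -[ab db] [ac dc] bc [bb cc] ad.
have bcE : b * c = - ((p * q^-1) *: (c * b)) by apply/eqP; rewrite -addr_eq0 bc.
have bcb : b * c * b = 0 by rewrite bcE mulNr -scalerAl -mulrA bb mulr0 scaler0 oppr0.
have cbbc : c * b * (b * c) = 0 by rewrite mulrA -(mulrA c) bb mulr0 mul0r.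
have bd : b * d = q^-1 *: d * b by rewrite -scalerAl db scalerA mulVf // scale1r.
have bca : b * c * a = (p * q)^-1 *: (a * (b * c)).
  rewrite mulrA ab -scalerAl -[b * a * c]mulrA ac -scalerAr !scalerA mulrA.
  by rewrite -[_^-1 * q * p]mulrA [q * p]mulrC mulVf ?mulf_neq0 // scale1r.
have dbc : d * (b * c) = (p * q) *: (b * c * d).
  rewrite mulrA db -scalerAl -[b * d * c]mulrA dc -scalerAr scalerA.
  by rewrite [q * p]mulrC mulrA.
(* The commutator of [a] and [d] is a multiple of [c * b], which kills [b * c] because
   [b * b = 0]. *)
have dabc : d * a * (b * c) = a * d * (b * c).
  by apply/esym/subr0_eq; rewrite -mulrBl ad -scalerAl cbbc scaler0.
split.
  rewrite FpolyS_mul //; last first.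
    (* The scalar is the one in [dbc]; rescaling [d] by q^-1 leaves it unchanged. *)
    move=> k; apply: (@exp_swap_mul _ _ (p * q)).
      by rewrite -scalerAl dbc -scalerAr !scalerA mulrC.
    by rewrite -!scalerAl dabc -scalerAr -scalerAl.
  by rewrite mulrDl -exprSr -[_ * (b * c) * a]mulrA bca -scalerAr !mulrA addrA.
rewrite mulrDl -[_ * (b * c) * b]mulrA bcb mulr0 addr0 GpolyS mulrDl.
by rewrite -!mulrA bd.
Qed.

Lemma mx22_mul (A : nzRingType) (a b c d a' b' c' d' : A) :
  mx22 a b c d * mx22 a' b' c' d' =
  mx22 (a * a' + b * c') (a * b' + b * d') (c * a' + d * c') (c * b' + d * d').
Proof.
apply/matrixP => i j; rewrite !mxE !big_ord_recl big_ord0 addr0 !mxE /=.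
by case: (i == 0); case: (j == 0).
Qed.

Theorem lemma3p1 (R : realType) (A : algType R[i]) (p q : R[i])
    (a beta gamma d : A)
    (p_neq0 : p <> 0) (q_neq0 : q <> 0)
    (pq_neq1 : p * q <> 1) (pq_neqN1 : p * q <> -1)
    (a_inv : invertible a) (d_inv : invertible d)
    (T_GL : in_GLpq p q (mx22 a beta gamma d))
    (n : nat) (n_gt0 : (0 < n)%N) :
  mx22 a beta gamma d ^+ n =
  mx22 (a ^+ n + Fpoly (p * q) n a (q^-1 *: d) * (beta * gamma))
       (Gpoly n a (q^-1 *: d) * beta)
       (Gpoly n d (p^-1 *: a) * gamma)
       (d ^+ n + Fpoly (p * q) n d (p^-1 *: a) * (gamma * beta)).
Proof.
move/eqP: p_neq0 => p0; move/eqP: q_neq0 => q0; move/eqP: pq_neq1 => pq1.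
have T_GL' := GLpq_sym p0 q0 T_GL.
have qp1 : q * p != 1 by rewrite mulrC.
(* The induction starts at the identity matrix: for n = 0 all sums are empty, as [0.-1 = 0]. *)
clear n_gt0; elim: n => [|n IH].
  rewrite /Fpoly /Gpoly !big_geq // !mul0r !addr0 !expr0.
  apply/matrixP => i j; rewrite !mxE.
  by case: i => [[|[|[]]] ?] //; case: j => [[|[|[]]] ?].
have [An Bn] := GLpq_top_row n p0 q0 pq1 T_GL.
have [Dn Cn] := GLpq_top_row n q0 p0 qp1 T_GL'.
rewrite [q * p]mulrC in Dn Cn.
(* In the bottom row the matrix product lists the C_n term first, whereas the swapped recursions
   list D_n first. *)
by rewrite exprSr IH mx22_mul An Bn [X in mx22 _ _ X _]addrC Cn
  [X in mx22 _ _ _ X]addrC Dn.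
Qed.
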